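(* Let $\mathcal A\in\mathbb C^{n_1\times n_2\times n_3}$, $\mathcal X^\star\in\mathbb C^{n_2\times n_4\times n_3}$, $\mathcal B\in\mathbb C^{n_1\times n_4\times n_3}$ satisfy $\mathcal A\mathcal X^\star=\mathcal B$ (t-product), let $\mathcal E_A\in\mathbb C^{n_1\times n_2\times n_3}$, $\mathcal E_B\in\mathbb C^{n_1\times n_4\times n_3}$ be fixed perturbation tensors, and put $\tilde{\mathcal A}=\mathcal A+\mathcal E_A$, $\tilde{\mathcal B}=\mathcal B+\mathcal E_B$. Let $$\mathcal I_+:=\{i\in[n_1]:\|\tilde{\mathcal A}_{i::}\|_F>0\}.$$ Assume that $\tilde{\mathcal A}_{i::}\tilde{\mathcal A}_{i::}^*$ is invertible (as a $1\times1\times n_3$ tensor under the t-product) for every row index $i$ that can be used in the iteration, i.e. every $i\in\mathcal I_+$, and that the block-circulant matrix $\operatorname{bcirc}(\tilde{\mathcal A})$ has full column rank. Let $\omega\in(0,2)$, $\lambda\ge0$, and let $(\mathcal X^t)_{t\ge0}$ be the spectrally damped tensor randomized Kaczmarz (SD-TRK) iterates $$\mathcal X^{t+1}=\mathcal X^t-\omega\,\tilde{\mathcal A}_{i_t::}^*\left(\tilde{\mathcal A}_{i_t::}\tilde{\mathcal A}_{i_t::}^*+\lambda\mathcal I\right)^{-1}\left(\tilde{\mathcal A}_{i_t::}\mathcal X^t-\tilde{\mathcal B}_{i_t::}\right),$$ where $i_t$ is sampled independently at each iteration $t$ according to $$p_i=\frac{\|\tilde{\mathcal A}_{i::}\|_F^2}{\|\tilde{\mathcal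 A}\|_F^2},\qquad i\in[n_1].$$ Let $\mathcal E^t:=\mathcal X^t-\mathcal X^\star$. Then for any $\alpha>0$ and every $t\ge0$, $$\mathbb E\left[\|\mathcal E^{t+1}\|_F^2\right]\le\rho_\alpha(\omega,\lambda)\,\mathbb E\left[\|\mathcal E^t\|_F^2\right]+\eta_\alpha(\omega,\lambda)\,\|\mathcal E_A\mathcal X^\star-\mathcal E_B\|_F^2,$$ where $$\underline p:=\min_{i\in[n_1]:\,p_i>0}p_i,\qquad \rho_\alpha(\omega,\lambda):=(1+\alpha)\left(1-\underline p\,\frac{(2\omega-\omega^2)\,\sigma_{\min}^2(\operatorname{bcirc}(\tilde{\mathcal A}))}{\sigma_{\max}^2(\operatorname{bcirc}(\tilde{\mathcal A}))+\lambda}\right),$$ $$\eta_\alpha(\omega,\lambda):=\left(1+\frac1\alpha\right)\eta(\omega,\lambda),\qquad \eta(\omega,\lambda):=n_3\,\omega^2\max_{i\in\mathcal I_+}\left\|\tilde{\mathcal A}_{i::}^*\left(\tilde{\mathcal A}_{i::}\tilde{\mathcal A}_{i::}^*+\lambda\mathcal I\right)^{-1}\right\|_F^2 .$$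
   Context: Notation. $[m]=\{1,\dots,m\}$. For a third-order tensor $\mathcal A\in\mathbb C^{n_1\times n_2\times n_3}$: $\mathcal A_{i::}\in\mathbb C^{1\times n_2\times n_3}$ is its $i$-th horizontal (row) slice, $\mathcal A_{::k}$ its $k$-th frontal slice, and $\|\mathcal A\|_F=(\sum_{i,j,k}|\mathcal A_{ijk}|^2)^{1/2}$. For a matrix, $\sigma_{\min}$ and $\sigma_{\max}$ denote the smallest and largest singular values. t-product. With $A^{(k)}=\mathcal A_{::k}$, $\operatorname{bcirc}(\mathcal A)\in\mathbb C^{n_1n_3\times n_2n_3}$ is the block-circulant matrix whose $(p,q)$ block ($p,q\in[n_3]$) is $A^{(r)}$ with $r\in[n_3]$, $r\equiv p-q+1 \pmod{n_3}$ (so the first block column is $A^{(1)},\dots,A^{(n_3)}$ from top to bottom). $\operatorname{unfold}(\mathcal A)$ stacks the frontal slices $\mathcal A_{::1},\dots,\mathcal A_{::n_3}$ vertically, and $\operatorname{fold}$ is its inverse. The t-product of $\mathcal A\in\mathbb C^{n_1\times n_2\times n_3}$ and $\mathcal B\in\mathbb C^{n_2\times n_4\times n_3}$ is $\mathcal A\mathcal B=\operatorname{fold}(\operatorname{bcirc}(\mathcal A)\operatorname{unfold}(\mathcal B))\in\mathbb C^{n_1\times n_4\times n_3}$; all products of tensors are t-products. The identity tensor $\mathcal I$ of size $n\times n\times n_3$ has first frontal slice equal to the $n\times n$ identity matrix and all other entries zero (in $\tilde{\mathcal A}_{i::}\tilde{\mathcal A}_{i::}^*+\lambda\mathcal I$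 it is the $1\times1\times n_3$ identity tensor). The conjugate transpose $\mathcal A^*$ is obtained by taking the conjugate transpose of every frontal slice and reversing the order of frontal slices $2,\dots,n_3$. A tensor $\mathcal A$ is invertible if there is $\mathcal A^{-1}$ with $\mathcal A\mathcal A^{-1}=\mathcal A^{-1}\mathcal A=\mathcal I$. The initial iterate $\mathcal X^0\in\mathbb C^{n_2\times n_4\times n_3}$ is a given tensor, and $\mathbb E[\cdot]$ denotes expectation with respect to the randomized row selection. *)

(* Defs.v *)
From HB Require Import structures.
From mathcomp Require Import all_boot all_order all_algebra.
From mathcomp Require Import sesquilinear spectral complex.
From mathcomp Require Import all_classical all_reals all_analysis.

Set Implicit Arguments.
Unset Strict Implicit.
Unset Printing Implicit Defensive.

Import Order.TTheory GRing.Theory Num.Theory.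
Import numFieldNormedType.Exports.

Local Open Scope classical_set_scope.
Local Open Scope complex_scope.
Local Open Scope sesquilinear_scope.
Local Open Scope ring_scope.

(* A tensor is the family of its frontal slices, indexed from 0:
   [A k i j] is the (i+1, j+1, k+1) entry. Addition and scaling are those
   of [{ffun _ -> _}]. *)
Notation tensor R n1 n2 n3 := {ffun 'I_n3 -> 'M[R[i]]_(n1, n2)}.

Lemma ord_pos n (k : 'I_n) : (0 < n)%N.
Proof. exact: leq_ltn_trans (leq0n k) (ltn_ord k). Qed.

Definition ord_submod n (p q : 'I_n) : 'I_n :=
  Ordinal (ltn_pmod (p + (n - q)) (ord_pos p)).

Definition ord_oppmod n (k : 'I_n) : 'I_n :=
  Ordinal (ltn_pmod (n - k) (ord_pos k)).

Definition bcirc (R : realType) n1 n2 n3 (A : tensor R n1 n2 n3) :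
    'M[R[i]]_(\sum_(p < n3) n1, \sum_(q < n3) n2) :=
  \mxblock_(p < n3, q < n3) A (ord_submod p q).

Definition unfold (R : realType) n1 n2 n3 (A : tensor R n1 n2 n3) :
    'M[R[i]]_(\sum_(k < n3) n1, n2) :=
  \mxcol_(k < n3) A k.

Definition fold (R : realType) n1 n2 n3
    (M : 'M[R[i]]_(\sum_(k < n3) n1, n2)) : tensor R n1 n2 n3 :=
  [ffun k => submxcol M k].

Definition tmul (R : realType) n1 n2 n4 n3
    (A : tensor R n1 n2 n3) (B : tensor R n2 n4 n3) : tensor R n1 n4 n3 :=
  fold (bcirc A *m unfold B).

Notation "A *t B" := (tmul A B) (at level 40, left associativity).

Definition tid (R : realType) n n3 : tensor R n n n3 :=
  [ffun k : 'I_n3 => if val k == 0%N then 1%:M else 0].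

Arguments tid {R n n3}.

Definition tctr (R : realType) n1 n2 n3 (A : tensor R n1 n2 n3) :
    tensor R n2 n1 n3 :=
  [ffun k => (A (ord_oppmod k))^t*].

Definition is_tinv (R : realType) n n3 (A B : tensor R n n n3) : Prop :=
  A *t B = tid /\ B *t A = tid.

Definition tinvertible (R : realType) n n3 (A : tensor R n n n3) : Prop :=
  exists B, is_tinv A B.

(* The inverse is a tensor satisfying [is_tinv A]; the value is the junk [A]
   when there is none. *)
Definition tinv (R : realType) n n3 (A : tensor R n n n3) : tensor R n n n3 :=
  xget A [set B | is_tinv A B].

Definition hslice (R : realType) n1 n2 n3 (A : tensor R n1 n2 n3)
    (i : 'I_n1) : tensor R 1 n2 n3 :=
  [ffun k => row i (A k)].

(* [`|z|] is itself in [R[i]]; its real part is the modulus as an element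
   of [R]. *)
Definition frob (R : realType) n1 n2 n3 (A : tensor R n1 n2 n3) : R :=
  Num.sqrt (\sum_i \sum_j \sum_k (complex.Re `|A k i j|) ^+ 2).

(* [A^t* *m A] is normal, so [spectral_diag] lists its eigenvalues with
   multiplicity. There are n of them; only the minn m n largest give
   singular values of the m x n matrix A. *)
Definition singular_values (R : realType) m n (A : 'M[R[i]]_(m, n)) : seq R :=
  take (minn m n)
    (sort >=%R [seq Num.sqrt (complex.Re (spectral_diag (A^t* *m A) ord0 j))
               | j <- enum 'I_n]).

Definition sigma_max (R : realType) m n (A : 'M[R[i]]_(m, n)) : R :=
  head 0 (singular_values A).

Definition sigma_min (R : realType) m n (A : 'M[R[i]]_(m, n)) : R :=
  last 0 (singular_values A).

Definition Iplus (R : realType) n1 n2 n3 (A : tensor R n1 n2 n3) :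
    {pred 'I_n1} :=
  [pred i | 0 < frob (hslice A i)].

Definition row_prob (R : realType) n1 n2 n3 (A : tensor R n1 n2 n3)
    (i : 'I_n1) : R :=
  frob (hslice A i) ^+ 2 / frob A ^+ 2.

(* The neutral element 1 is harmless, since each probability is at most 1. *)
Definition min_row_prob (R : realType) n1 n2 n3 (A : tensor R n1 n2 n3) : R :=
  \big[Num.min/1]_(i < n1 | 0 < row_prob A i) row_prob A i.

Definition damped_pinv (R : realType) n1 n2 n3 (A : tensor R n1 n2 n3)
    (lambda : R) (i : 'I_n1) : tensor R n2 1 n3 :=
  let Ai := hslice A i in
  tctr Ai *t tinv (Ai *t tctr Ai + lambda%:C *: tid).

Fixpoint sdtrk (R : realType) n1 n2 n3 n4
    (A : tensor R n1 n2 n3) (B : tensor R n1 n4 n3) (omega lambda : R)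
    (X0 : tensor R n2 n4 n3) (rows : nat -> 'I_n1) (t : nat) :
    tensor R n2 n4 n3 :=
  if t is s.+1 then
    let X := sdtrk A B omega lambda X0 rows s in
    let i := rows s in
    X - omega%:C *:
      (damped_pinv A lambda i *t (hslice A i *t X - hslice B i))
  else X0.

(* 'I_n carries the discrete sigma-algebra. *)
Definition iid_sampling d (Omega : measurableType d) (R : realType)
    (P : probability Omega R) n (p : 'I_n -> R)
    (rows : nat -> Omega -> 'I_n) : Prop :=
  [/\ forall t (D : set 'I_n), measurable (rows t @^-1` D),
      forall t (k : 'I_n), P (rows t @^-1` [set k]) = (p k)%:E
    & forall (s : seq nat) (D : nat -> set 'I_n), uniq s ->
        P (\bigcap_(t in [set` s]) (rows t @^-1` D t)) =
        (\prod_(t <- s) P (rows t @^-1` D t))%E].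

Definition rho_alpha (R : realType) n1 n2 n3 (A : tensor R n1 n2 n3)
    (alpha omega lambda : R) : R :=
  (1 + alpha) *
  (1 - min_row_prob A *
       (((2 * omega - omega ^+ 2) * sigma_min (bcirc A) ^+ 2) /
        (sigma_max (bcirc A) ^+ 2 + lambda))).

(* The neutral element 0 is harmless, since the terms are nonnegative. *)
Definition eta (R : realType) n1 n2 n3 (A : tensor R n1 n2 n3)
    (omega lambda : R) : R :=
  n3%:R * omega ^+ 2 *
  \big[Num.max/0]_(i in Iplus A) frob (damped_pinv A lambda i) ^+ 2.

Definition eta_alpha (R : realType) n1 n2 n3 (A : tensor R n1 n2 n3)
    (alpha omega lambda : R) : R :=
  (1 + alpha^-1) * eta A omega lambda.

(* Main.v *)
Require Import Defs.
From HB Require Import structures.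
From mathcomp Require Import all_boot all_order all_algebra.
From mathcomp Require Import sesquilinear spectral complex ring lra.
From mathcomp Require Import all_classical all_reals all_analysis.
From mathcomp Require Import measurable_realfun.

Set Implicit Arguments.
Unset Strict Implicit.
Unset Printing Implicit Defensive.

Import Order.TTheory GRing.Theory Num.Theory.

Local Open Scope ring_scope.

(** The t-product is block-circulant matrix multiplication, so tensors carry
    the real inner product [tdot X Y = Re tr(Y^* X)], summed over frontal
    slices, for which multiplication by [tctr A] is adjoint to multiplication
    by [A] ([tdotMl]) and whose square norm is the Frobenius one ([frobE]).

    Write [E = X - Xs], [At = A + EA], [a] for the sampled row slice of [At],
    [D = a a^* + lambda], [r = EA Xs - EB].  Since the true system is
    consistent, the sampled residual is [a E] plus the same row of [r], hence
    the new error is [E - omega W] minus [omega a^* D^-1] times that row, with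
    [W = a^* Z] and [Z = D^-1 a E] ([sdtrk_error]).  Young's inequality
    separates the two contributions, which gives the factors [1 + alpha] and
    [1 + 1/alpha].

    The noise term is bounded by submultiplicativity of the Frobenius norm
    of [bcirc], where every entry of a tensor occurs [n3] times ([tdotM_le]).

    For the main term, adjointness gives [<E, W> = <D Z, Z> = |W|^2 + lambda
    |Z|^2], and the operator inequality [D^2 <= (sigma_max^2 + lambda) D]
    evaluated at [Z] bounds this below by
    [|a E|^2 / (sigma_max^2 + lambda)], so that [E - omega W] loses at least
    [(2 omega - omega^2) |a E|^2 / (sigma_max^2 + lambda)] of square norm
    ([damped_projection_le]).  Averaging over the sampled row, rows of
    probability zero vanish and the others have probability at least
    [min_row_prob], so the mean of [|a E|^2] is at least [min_row_prob |At E|^2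
    >= min_row_prob sigma_min^2 |E|^2] ([expected_residual_ge]).  The extreme
    singular values enter through the spectral theorem for the Gram matrix.

    The iterate at time [t] is a function of the history of the first [t] sampled
    rows, which takes finitely many values, and independence makes the law of a
    history extended by one row a product law; the conditional estimate for one
    step is therefore summed over the histories ([expectation_one_step]). *)

(** * The real inner product of complex matrices *)

Section MatrixDot.
Local Open Scope sesquilinear_scope.
Local Open Scope complex_scope.
Context {R : realType}.
Implicit Types m n p : nat.

Lemma complex_ReD (x y : R[i]) : complex.Re (x + y) = complex.Re x + complex.Re y.
Proof. by case: x y => [? ?] [? ?]. Qed.

Lemma complex_Re_sum I (r : seq I) (Q : pred I) (F : I -> R[i]) :
  complex.Re (\sum_(i <- r | Q i) F i) = \sum_(i <- r | Q i) complex.Re (F i).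
Proof. exact: (big_morph _ complex_ReD). Qed.

Lemma complex_Re_conj (z : R[i]) : complex.Re (Num.conj z) = complex.Re z.
Proof. by case: z. Qed.

Lemma complex_ReMl (a : R) (z : R[i]) : complex.Re (a%:C * z) = a * complex.Re z.
Proof. by case: z => x y /=; rewrite mul0r subr0. Qed.

Lemma complex_Re_normsq (z : R[i]) : complex.Re (Num.conj z * z) = complex.Re `|z| ^+ 2.
Proof.
rewrite mulrC -normCK; case: z => x y; rewrite normc_def /=.
by rewrite mulr0 subr0.
Qed.

Definition mxdot m n (X Y : 'M[R[i]]_(m, n)) : R := complex.Re (\tr (Y^t* *m X)).

Lemma adjmxM m n p (X : 'M[R[i]]_(m, n)) (Y : 'M[R[i]]_(n, p)) :
  (X *m Y)^t* = Y^t* *m X^t*.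
Proof. by rewrite trmx_mul map_mxM. Qed.

Lemma mxdotDl m n (X Y Z : 'M[R[i]]_(m, n)) :
  mxdot (X + Y) Z = mxdot X Z + mxdot Y Z.
Proof. by rewrite /mxdot mulmxDr mxtraceD complex_ReD. Qed.

Lemma mxdotZl m n a (X Z : 'M[R[i]]_(m, n)) :
  mxdot (a%:C *: X) Z = a * mxdot X Z.
Proof. by rewrite /mxdot -scalemxAr mxtraceZ complex_ReMl. Qed.

Lemma mxdot0 p q (Y : 'M[R[i]]_(p, q)) : mxdot 0 Y = 0.
Proof. by rewrite /mxdot mulmx0 mxtrace0. Qed.

Lemma mxdotC m n (X Y : 'M[R[i]]_(m, n)) : mxdot X Y = mxdot Y X.
Proof.
rewrite /mxdot -complex_Re_conj -trace_map_mx -mxtrace_tr.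
by rewrite map_trmx adjmxM trmxCK.
Qed.

Lemma mxdotE m n (X : 'M[R[i]]_(m, n)) :
  mxdot X X = \sum_i \sum_j complex.Re `|X i j| ^+ 2.
Proof.
rewrite /mxdot /mxtrace complex_Re_sum exchange_big /=; apply: eq_bigr => j _.
rewrite mxE complex_Re_sum; apply: eq_bigr => i _.
by rewrite !mxE complex_Re_normsq.
Qed.

Lemma mxdot_ge0 m n (X : 'M[R[i]]_(m, n)) : 0 <= mxdot X X.
Proof. by rewrite mxdotE !sumr_ge0 // => i _; rewrite sumr_ge0 // => j _; rewrite sqr_ge0. Qed.

Lemma mxdot_eq0 m n (X : 'M[R[i]]_(m, n)) : mxdot X X = 0 -> X = 0.
Proof.
rewrite mxdotE => /psumr_eq0P X0; apply/matrixP => i j.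
have /psumr_eq0P Xi0 := X0 (fun i _ => sumr_ge0 _ (fun j _ => sqr_ge0 _)) i isT.
have /eqP := Xi0 (fun j _ => sqr_ge0 _) j isT.
rewrite sqrf_eq0 mxE normc_def /= => /eqP r0; apply/eqP.
by rewrite -normr_eq0 normc_def r0.
Qed.

Lemma mxdotMl m n p (A : 'M[R[i]]_(m, n)) (X : 'M[R[i]]_(n, p)) Y :
  mxdot (A *m X) Y = mxdot X (A^t* *m Y).
Proof. by rewrite /mxdot adjmxM trmxCK mulmxA. Qed.

Lemma mxdotMr m n p (A : 'M[R[i]]_(m, n)) (X : 'M[R[i]]_(n, p)) Y :
  mxdot Y (A *m X) = mxdot (A^t* *m Y) X.
Proof. by rewrite mxdotC mxdotMl mxdotC. Qed.

Lemma mxdot_rows m n (X Y : 'M[R[i]]_(m, n)) :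
  mxdot X Y = \sum_i mxdot (row i X) (row i Y).
Proof.
rewrite /mxdot -complex_Re_sum; congr complex.Re; rewrite mxtrace_mulC.
apply: eq_bigr => i _; rewrite -mxtrace_mulC trace_mx11 !mxE.
by apply: eq_bigr => j _; rewrite !mxE.
Qed.

Lemma mxdot_cols m n (X Y : 'M[R[i]]_(m, n)) :
  mxdot X Y = \sum_j mxdot (col j X) (col j Y).
Proof.
rewrite /mxdot -complex_Re_sum; congr complex.Re.
apply: eq_bigr => j _; rewrite trace_mx11 !mxE.
by apply: eq_bigr => i _; rewrite !mxE.
Qed.

Lemma mxdot_mxcol m n p (X Y : 'I_p -> 'M[R[i]]_(m, n)) :
  mxdot (\mxcol_k X k) (\mxcol_k Y k) = \sum_k mxdot (X k) (Y k).
Proof.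
rewrite /mxdot; have -> : (\mxcol_k Y k)^t* = \mxrow_k (Y k)^t*.
  by rewrite tr_mxcol; apply/matrixP => i j; rewrite !mxE.
rewrite -complex_Re_sum mul_mxrow_mxcol.
by rewrite [\tr _]raddf_sum.
Qed.

Lemma mxdot_suml I (r : seq I) (P : pred I) m n (F : I -> 'M[R[i]]_(m, n)) Y :
  mxdot (\sum_(i <- r | P i) F i) Y = \sum_(i <- r | P i) mxdot (F i) Y.
Proof.
apply: (big_morph (fun X => mxdot X Y)) => [X Z|]; first exact: mxdotDl.
exact: mxdot0.
Qed.

Lemma mxdot_sumr I (r : seq I) (P : pred I) m n (F : I -> 'M[R[i]]_(m, n)) Y :
  mxdot Y (\sum_(i <- r | P i) F i) = \sum_(i <- r | P i) mxdot Y (F i).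
Proof. by rewrite mxdotC mxdot_suml; apply: eq_bigr => i _; rewrite mxdotC. Qed.

Lemma mxdot_mxrow m n p (X Y : 'I_p -> 'M[R[i]]_(m, n)) :
  mxdot (\mxrow_k X k) (\mxrow_k Y k) = \sum_k mxdot (X k) (Y k).
Proof.
rewrite /mxdot; have -> : (\mxrow_k Y k)^t* = \mxcol_k (Y k)^t*.
  by rewrite tr_mxrow; apply/matrixP => i j; rewrite !mxE.
rewrite mxtrace_mulC mul_mxrow_mxcol [\tr _]raddf_sum /= complex_Re_sum.
by apply: eq_bigr => k _; rewrite mxtrace_mulC.
Qed.

Lemma mxtrace_gram m n (X : 'M[R[i]]_(m, n)) : \tr (X^t* *m X) = (mxdot X X)%:C.
Proof.
rewrite /mxdot; have : \tr (X^t* *m X) \is Num.real.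
  rewrite ger0_real // sumr_ge0 // => j _; rewrite mxE sumr_ge0 // => i _.
  by rewrite !mxE mulrC mul_conjC_ge0.
by move=> /RRe_real.
Qed.

(** A Gram matrix has real trace, so only the real part of a complex scalar
    survives; eigenvalues can then be used through their real parts, which is
    how [singular_values] reads them. *)
Lemma mxdotZ_self m n (c : R[i]) (X : 'M[R[i]]_(m, n)) :
  mxdot (c *: X) X = complex.Re c * mxdot X X.
Proof.
rewrite {1}/mxdot -scalemxAr mxtraceZ mxtrace_gram.
by case: c => x y /=; rewrite mulr0 subr0.
Qed.

Lemma mxdot_row_col_le n (u : 'rV[R[i]]_n) (v : 'cV[R[i]]_n) :
  complex.Re `|(u *m v) 0 0| ^+ 2 <= mxdot u u * mxdot v v.
Proof.
have : `|dotmx u (v^t*)| ^+ 2 <= dotmx u u * dotmx (v^t*) (v^t*).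
  exact: (CauchySchwarz (@dotmx _ n) u (v^t*)).1.
have -> : dotmx u (v^t*) = (u *m v) 0 0 by rewrite dotmxE trmxCK.
have -> : dotmx u u = (mxdot u u)%:C.
  by rewrite dotmxE -trace_mx11 mxtrace_mulC mxtrace_gram.
have -> : dotmx (v^t*) (v^t*) = (mxdot v v)%:C.
  by rewrite dotmxE -trace_mx11 trmxCK mxtrace_gram.
rewrite -rmorphM; set z := (u *m v) 0 0.
have /RRe_real <- : `|z| \is Num.real by rewrite normr_real.
by rewrite -rmorphXn lecR.
Qed.

(** Cauchy-Schwarz applied to each entry of the product. *)
Lemma mxdotM_le m n p (M : 'M[R[i]]_(m, n)) (N : 'M[R[i]]_(n, p)) :
  mxdot (M *m N) (M *m N) <= mxdot M M * mxdot N N.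
Proof.
rewrite mxdotE [mxdot M M]mxdot_rows mulr_suml ler_sum // => i _.
rewrite [mxdot N N]mxdot_cols mulr_sumr ler_sum // => j _.
apply: le_trans (mxdot_row_col_le (row i M) (col j N)).
suff -> : (row i M *m col j N) 0 0 = (M *m N) i j by [].
by rewrite !mxE; apply: eq_bigr => k _; rewrite !mxE.
Qed.
End MatrixDot.

(** * Extreme singular values as Rayleigh bounds *)

Section SingularValues.
Local Open Scope sesquilinear_scope.
Local Open Scope complex_scope.
Context {R : realType} {m n : nat}.
Variable M : 'M[R[i]]_(m, n).

Let gram := M^t* *m M.
Let V := spectralmx gram.
Let ev j := complex.Re (spectral_diag gram ord0 j).

Lemma gram_spectral : gram = V^t* *m diag_mx (spectral_diag gram) *m V.
Proof.
have /orthomx_spectralP : gram \is normalmx.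
  by apply/normalmxP; rewrite /gram adjmxM trmxCK.
by rewrite invmx_unitary ?spectral_unitarymx.
Qed.

(** The unitary change of basis [V] that diagonalises the Gram matrix turns
    [|M X|^2] into a weighted sum whose weights are the squared singular
    values; [mxdot_spectral] is the same sum with unit weights, so bounds on
    the weights are Rayleigh bounds. *)
Lemma mxdot_gram p (X : 'M[R[i]]_(n, p)) :
  mxdot (M *m X) (M *m X) =
  \sum_j ev j * mxdot (row j (V *m X)) (row j (V *m X)).
Proof.
rewrite mxdotMr mulmxA -/gram gram_spectral -!mulmxA -mxdotMr mxdot_rows.
apply: eq_bigr => j _.
by rewrite (row_mul j (diag_mx _)) row_diag_mx -scalemxAl -rowE mxdotZ_self.
Qed.

Lemma mxdot_spectral p (X : 'M[R[i]]_(n, p)) :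
  mxdot X X = \sum_j mxdot (row j (V *m X)) (row j (V *m X)).
Proof.
rewrite -mxdot_rows mxdotMl mulmxA.
have /unitarymxP/mulmx1C -> := spectral_unitarymx gram.
by rewrite mul1mx.
Qed.

(** The eigenvalue is [|M x|^2] at the unit eigenvector [x]; without its sign,
    squaring the square root in [singular_values] would not return it. *)
Lemma gram_eigenvalue_ge0 j : 0 <= ev j.
Proof.
have := mxdot_ge0 (M *m (V^t* *m delta_mx j (0 : 'I_1))).
rewrite mxdot_gram mulmxA (unitarymxP (spectral_unitarymx gram)) mul1mx.
rewrite (bigD1 j) //= big1 => [|k kj].
  rewrite mxdotE 2!big_ord1 !mxE !eqxx normr1 expr1n /=.
  by rewrite addr0 mulr1.
rewrite (_ : row k _ = 0) ?mxdot0 ?mulr0 //.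
by apply/matrixP => a b; rewrite !mxE (negPf kj).
Qed.

(* All [n] square roots of eigenvalues; [singular_values] keeps the first
   [minn m n] of them. *)
Let sv := sort >=%R [seq Num.sqrt (ev j) | j <- enum 'I_n].

Lemma sorted_sv : sorted >=%R sv.
Proof. by apply: sort_sorted => x y; apply: le_total. Qed.

Lemma size_sorted_sv : size sv = n.
Proof. by rewrite size_sort size_map size_enum_ord. Qed.

Lemma sorted_sv_index j : exists2 k, (k < n)%N & nth 0 sv k = Num.sqrt (ev j).
Proof.
have : Num.sqrt (ev j) \in sv.
  by rewrite mem_sort; apply/mapP; exists j; rewrite ?mem_enum.
by move/(nthP 0) => [k]; rewrite size_sorted_sv; exists k.
Qed.

Lemma nth_sorted_sv_ge0 k : 0 <= nth 0 sv k.
Proof.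
have [kn|kn] := ltnP k (size sv); last by rewrite nth_default.
have := mem_nth 0 kn; rewrite mem_sort => /mapP [j _ ->].
exact: sqrtr_ge0.
Qed.

Lemma eigenvalue_le_sigma_max j : (0 < m)%N -> ev j <= sigma_max M ^+ 2.
Proof.
move=> m0; have n0 := ord_pos j; have [k kn svk] := sorted_sv_index j.
have sE : sigma_max M = nth 0 sv 0.
  by rewrite /sigma_max /singular_values -/gram -nth0 nth_take ?leq_min ?m0.
rewrite -[ev j]sqr_sqrtr ?gram_eigenvalue_ge0 // -svk sE.
rewrite lerXn2r ?nnegrE ?nth_sorted_sv_ge0 //.
by apply: (sorted_leq_nth ge_trans ge_refl 0 sorted_sv);
  rewrite ?inE ?size_sorted_sv.
Qed.

(** When [n <= m] the truncation in [singular_values] keeps the whole list,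
    whose last element is the smallest one.  For [m < n] the bound fails: the
    Gram matrix is then singular, while [sigma_min M] may be positive. *)
Lemma sigma_min_le_eigenvalue j : (n <= m)%N -> sigma_min M ^+ 2 <= ev j.
Proof.
move=> nm; have n0 := ord_pos j; have [k kn svk] := sorted_sv_index j.
have sE : sigma_min M = nth 0 sv n.-1.
  rewrite /sigma_min /singular_values -/gram (minn_idPr nm).
  by rewrite take_oversize ?size_sorted_sv // -nth_last size_sorted_sv.
rewrite -[ev j]sqr_sqrtr ?gram_eigenvalue_ge0 // -svk sE.
rewrite lerXn2r ?nnegrE ?nth_sorted_sv_ge0 //.
apply: (sorted_leq_nth ge_trans ge_refl 0 sorted_sv);
  rewrite ?inE ?size_sorted_sv ?prednK //.
by rewrite -ltnS prednK.
Qed.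

Lemma mxdot_le_sigma_max p (X : 'M[R[i]]_(n, p)) : (0 < m)%N ->
  mxdot (M *m X) (M *m X) <= sigma_max M ^+ 2 * mxdot X X.
Proof.
move=> m0; rewrite mxdot_gram mxdot_spectral mulr_sumr ler_sum // => j _.
by rewrite ler_wpM2r ?mxdot_ge0 ?eigenvalue_le_sigma_max.
Qed.

Lemma mxdot_ge_sigma_min p (X : 'M[R[i]]_(n, p)) : (n <= m)%N ->
  sigma_min M ^+ 2 * mxdot X X <= mxdot (M *m X) (M *m X).
Proof.
move=> m0; rewrite mxdot_gram mxdot_spectral mulr_sumr ler_sum // => j _.
by rewrite ler_wpM2r ?mxdot_ge0 ?sigma_min_le_eigenvalue.
Qed.
End SingularValues.

(** * The algebra of the t-product *)

Section CyclicIndices.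
Context {n : nat}.
Implicit Types k q s : 'I_n.

Lemma ord_submodK k q : (ord_submod k q + q = k %[mod n])%N.
Proof. by rewrite /= modnDml -addnA subnK ?modnDr // ltnW. Qed.

Lemma ord_oppmodK k : (ord_oppmod k + k = 0 %[mod n])%N.
Proof. by rewrite /= modnDml subnK ?modnn ?mod0n // ltnW. Qed.

Lemma ord_addmodI (q : nat) k s : (k + q = s + q %[mod n])%N -> k = s.
Proof.
move/eqP; rewrite eqn_modDr !modn_small // => /eqP; exact: val_inj.
Qed.

(** This cancellation is what makes the convolution defining the t-product
    associative. *)
Lemma ord_submod_sub k q s : ord_submod (ord_submod k q) (ord_submod s q) = ord_submod k s.
Proof.
apply: (@ord_addmodI s); rewrite ord_submodK -modnDmr -[in LHS](ord_submodK s q).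
by rewrite modnDmr addnA -modnDml ord_submodK modnDml ord_submodK.
Qed.

(** The slice reversal in [tctr] negates the index modulo [n], so the
    [(q, k)] block of [bcirc (tctr A)] is the adjoint of the [(k, q)] block of
    [bcirc A]. *)
Lemma ord_oppmod_sub k q : ord_oppmod (ord_submod k q) = ord_submod q k.
Proof.
apply: (@ord_addmodI k); rewrite ord_submodK -modnDmr -[in LHS](ord_submodK k q).
by rewrite modnDmr addnA -modnDml ord_oppmodK modnDml.
Qed.

Lemma ord_submodl_inj q : injective (fun k => ord_submod k q).
Proof.
move=> k s ks; apply: (@ord_addmodI 0%N); rewrite !addn0.
by rewrite -(ord_submodK k q) ks ord_submodK.
Qed.

Lemma ord_submodr_inj k : injective (ord_submod k).
Proof.
move=> q s qs; apply: (@ord_addmodI (ord_submod k q)); rewrite addnC ord_submodK.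
by rewrite qs addnC ord_submodK.
Qed.

Lemma ord_submod_eq0 k q : (val (ord_submod k q) == 0)%N = (q == k).
Proof.
apply/eqP/eqP => [kq0|->]; last by rewrite /= subnKC ?modnn // ltnW.
by apply: (@ord_addmodI 0%N); rewrite !addn0 -(ord_submodK k q) kq0.
Qed.
End CyclicIndices.

Section TensorAlgebra.
Local Open Scope sesquilinear_scope.
Local Open Scope complex_scope.
Context {R : realType} {n3 : nat}.
Implicit Types m n p : nat.

Lemma sliceD m n (X Y : tensor R m n n3) k : (X + Y) k = X k + Y k.
Proof. exact: ffunE. Qed.

Lemma sliceZ m n c (X : tensor R m n n3) k : (c *: X) k = c *: X k.
Proof. exact: ffunE. Qed.

Lemma slice_hslice m n (X : tensor R m n n3) i k : hslice X i k = row i (X k).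
Proof. exact: ffunE. Qed.

(** The t-product is cyclic convolution along the third dimension, a
    form from which its algebraic laws follow by reindexing sums. *)
Lemma tmulE m n p (A : tensor R m n n3) (B : tensor R n p n3) k :
  (A *t B) k = \sum_q A (ord_submod k q) *m B q.
Proof. by rewrite ffunE mul_mxblock_mxrow mxcolK. Qed.

Lemma unfold_tmul m n p (A : tensor R m n n3) (B : tensor R n p n3) :
  unfold (A *t B) = bcirc A *m unfold B.
Proof.
rewrite -[RHS]submxcolK; apply: eq_mxcol => k; exact: ffunE.
Qed.

Lemma foldK m n : cancel (@fold R m n n3) (@unfold R m n n3).
Proof.
by move=> M; rewrite -[RHS]submxcolK; apply: eq_mxcol => k; rewrite ffunE.
Qed.

Lemma unfoldK m n : cancel (@unfold R m n n3) (@fold R m n n3).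
Proof. by move=> A; apply/ffunP => k; rewrite ffunE mxcolK. Qed.

Lemma tmulA m n p r (A : tensor R m n n3) (B : tensor R n p n3) (C : tensor R p r n3) :
  A *t (B *t C) = A *t B *t C.
Proof.
apply/ffunP => k; rewrite !tmulE.
under eq_bigr do rewrite tmulE mulmx_sumr.
rewrite exchange_big; apply: eq_bigr => q _ /=.
rewrite tmulE mulmx_suml [RHS](reindex_inj (@ord_submodl_inj _ q)) /=.
by apply: eq_bigr => s _; rewrite ord_submod_sub mulmxA.
Qed.

Lemma tmul1 m n (A : tensor R m n n3) : A *t tid = A.
Proof.
apply/ffunP => k; rewrite tmulE (reindex_inj (@ord_submodr_inj _ k)) /=.
rewrite (bigD1 k) //= big1 ?addr0 => [|q qk].
  rewrite ffunE ord_submod_eq0 eqxx mulmx1; congr (A _).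
  by apply: (@ord_addmodI _ (ord_submod k k)); rewrite ord_submodK addnC ord_submodK.
by rewrite ffunE ord_submod_eq0 (negPf qk) mulmx0.
Qed.

Lemma t1mul m n (A : tensor R m n n3) : tid *t A = A.
Proof.
apply/ffunP => k; rewrite tmulE (bigD1 k) //= big1 ?addr0 => [|q qk].
  by rewrite ffunE ord_submod_eq0 eqxx mul1mx.
by rewrite ffunE ord_submod_eq0 (negPf qk) mul0mx.
Qed.

Lemma tmulDl m n p (A B : tensor R m n n3) (C : tensor R n p n3) :
  (A + B) *t C = A *t C + B *t C.
Proof.
apply/ffunP => k; rewrite sliceD !tmulE -big_split; apply: eq_bigr => q _.
by rewrite sliceD mulmxDl.
Qed.

Lemma tmulDr m n p (A : tensor R m n n3) (B C : tensor R n p n3) :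
  A *t (B + C) = A *t B + A *t C.
Proof.
apply/ffunP => k; rewrite sliceD !tmulE -big_split; apply: eq_bigr => q _.
by rewrite sliceD mulmxDr.
Qed.

Lemma tmulZl m n p c (A : tensor R m n n3) (B : tensor R n p n3) :
  (c *: A) *t B = c *: (A *t B).
Proof.
apply/ffunP => k; rewrite sliceZ !tmulE scaler_sumr; apply: eq_bigr => q _.
by rewrite sliceZ -scalemxAl.
Qed.

Lemma tmulZr m n p c (A : tensor R m n n3) (B : tensor R n p n3) :
  A *t (c *: B) = c *: (A *t B).
Proof.
apply/ffunP => k; rewrite sliceZ !tmulE scaler_sumr; apply: eq_bigr => q _.
by rewrite sliceZ -scalemxAr.
Qed.

Lemma tmulBr m n p (A : tensor R m n n3) (B C : tensor R n p n3) :
  A *t (B - C) = A *t B - A *t C.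
Proof. by rewrite tmulDr -scaleN1r tmulZr scaleN1r. Qed.

Lemma hslice_tmul m n p (A : tensor R m n n3) (B : tensor R n p n3) i :
  hslice (A *t B) i = hslice A i *t B.
Proof.
apply/ffunP => k; rewrite slice_hslice !tmulE linear_sum; apply: eq_bigr => q _ /=.
by rewrite slice_hslice row_mul.
Qed.

Lemma hsliceD m n (A B : tensor R m n n3) i :
  hslice (A + B) i = hslice A i + hslice B i.
Proof. by apply/ffunP => k; rewrite !(slice_hslice, sliceD) linearD. Qed.

Definition tdot m n (X Y : tensor R m n n3) : R := \sum_k mxdot (X k) (Y k).

Lemma frobE m n (X : tensor R m n n3) : frob X ^+ 2 = tdot X X.
Proof.
rewrite sqr_sqrtr; last by do 3![apply: sumr_ge0 => ? _]; rewrite sqr_ge0.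
under eq_bigr do rewrite exchange_big /=.
by rewrite exchange_big; apply: eq_bigr => k _; rewrite mxdotE.
Qed.

Lemma tdotDl m n (X Y Z : tensor R m n n3) : tdot (X + Y) Z = tdot X Z + tdot Y Z.
Proof. by rewrite -big_split; apply: eq_bigr => k _; rewrite ffunE mxdotDl. Qed.

Lemma tdotZl m n a (X Y : tensor R m n n3) : tdot (a%:C *: X) Y = a * tdot X Y.
Proof. by rewrite mulr_sumr; apply: eq_bigr => k _; rewrite ffunE mxdotZl. Qed.

Lemma tdotC m n (X Y : tensor R m n n3) : tdot X Y = tdot Y X.
Proof. by apply: eq_bigr => k _; rewrite mxdotC. Qed.

Lemma tdotDr m n (X Y Z : tensor R m n n3) : tdot X (Y + Z) = tdot X Y + tdot X Z.
Proof. by rewrite tdotC tdotDl !(tdotC X). Qed.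

Lemma tdotZr m n a (X Y : tensor R m n n3) : tdot X (a%:C *: Y) = a * tdot X Y.
Proof. by rewrite tdotC tdotZl tdotC. Qed.

Lemma tdot_ge0 m n (X : tensor R m n n3) : 0 <= tdot X X.
Proof. by rewrite sumr_ge0 // => k _; apply: mxdot_ge0. Qed.

Lemma tdot_eq0 m n (X : tensor R m n n3) : tdot X X = 0 -> X = 0.
Proof.
move=> /psumr_eq0P X0; apply/ffunP => k; rewrite ffunE; apply: mxdot_eq0.
by apply: X0 => // q _; apply: mxdot_ge0.
Qed.

Lemma tdotMl m n p (A : tensor R m n n3) (X : tensor R n p n3) Y :
  tdot (A *t X) Y = tdot X (tctr A *t Y).
Proof.
rewrite /tdot; under eq_bigr do rewrite tmulE mxdot_suml.
rewrite exchange_big; apply: eq_bigr => q _ /=; rewrite tmulE mxdot_sumr.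
by apply: eq_bigr => k _; rewrite mxdotMl ffunE ord_oppmod_sub.
Qed.

Lemma tdot_rows m n (X Y : tensor R m n n3) :
  tdot X Y = \sum_i tdot (hslice X i) (hslice Y i).
Proof.
rewrite exchange_big; apply: eq_bigr => k _; rewrite mxdot_rows.
by apply: eq_bigr => i _; rewrite !slice_hslice.
Qed.

Lemma tdot_unfold m n (X Y : tensor R m n n3) : tdot X Y = mxdot (unfold X) (unfold Y).
Proof. by rewrite mxdot_mxcol. Qed.

(** Each slice of [A] occurs once in each of the [n3] block rows; this is the
    source of the factor [n3] in [eta]. *)
Lemma mxdot_bcirc m n (A : tensor R m n n3) :
  mxdot (bcirc A) (bcirc A) = n3%:R * tdot A A.
Proof.
rewrite /bcirc mxblockEv mxdot_mxcol.
rewrite -[n3 in n3%:R]card_ord mulr_natl -sumr_const; apply: eq_bigr => k _.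
by rewrite mxdot_mxrow [RHS](reindex_inj (@ord_submodr_inj _ k)).
Qed.

Lemma tdotM_le m n p (A : tensor R m n n3) (X : tensor R n p n3) :
  tdot (A *t X) (A *t X) <= n3%:R * tdot A A * tdot X X.
Proof. by rewrite -mxdot_bcirc !tdot_unfold unfold_tmul mxdotM_le. Qed.

(** [unfold] is an isometry that conjugates multiplication by [A] to the
    matrix [bcirc A], so singular values of [bcirc A] bound the t-product. *)
Lemma tdot_le_sigma_max m n p (A : tensor R m n n3) (X : tensor R n p n3) :
  (0 < m * n3)%N ->
  tdot (A *t X) (A *t X) <= sigma_max (bcirc A) ^+ 2 * tdot X X.
Proof.
move=> mn0; rewrite !tdot_unfold unfold_tmul mxdot_le_sigma_max //.
by rewrite sum_nat_const card_ord mulnC.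
Qed.

Lemma tdot_ge_sigma_min m n p (A : tensor R m n n3) (X : tensor R n p n3) :
  (n <= m)%N ->
  sigma_min (bcirc A) ^+ 2 * tdot X X <= tdot (A *t X) (A *t X).
Proof.
move=> nm; rewrite !tdot_unfold unfold_tmul mxdot_ge_sigma_min //.
by rewrite !sum_nat_const leq_mul2l nm orbT.
Qed.

End TensorAlgebra.

(** * Tensor inverses and the damped projection *)

(** The scalar core of [damped_projection_le], with [e = |E|^2],
    [w = |W|^2 = <A W, Z>], [z = |Z|^2], [aw = |A W|^2] and [s] a bound for
    [|A|^2].  The last hypothesis is [0 <= |A W - s Z|^2]; with [aw <= s w] it
    yields [w <= s z], that is [|A^* Z|^2 <= s |Z|^2], which passes the bound
    from [A] to its adjoint. *)
Lemma damped_quadratic_le (R : realFieldType) (s lambda omega e z w aw : R) :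
  0 < s -> 0 <= lambda -> 0 < omega < 2 -> 0 <= z -> aw <= s * w ->
  0 <= aw - 2 * s * w + s ^+ 2 * z ->
  e - 2 * omega * (w + lambda * z) + omega ^+ 2 * w <=
  e - (2 * omega - omega ^+ 2) / (s + lambda) *
      (aw + 2 * lambda * w + lambda ^+ 2 * z).
Proof.
move=> s0 l0 /andP [w_gt0 w_lt2] z0 aws saw.
have wz : w <= s * z.
  rewrite -(ler_pM2l s0).
  have -> : s * (s * z) = s ^+ 2 * z by ring.
  lra.
have sl : 0 < s + lambda by rewrite ltr_wpDr.
set q := aw + 2 * lambda * w + lambda ^+ 2 * z.
(* [q] is [|A E|^2 = |D Z|^2] and the right-hand side is [<D Z, Z>]: this is
   [D^2 <= (s + lambda) D] evaluated at [Z]. *)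
have qs : q / (s + lambda) <= w + lambda * z.
  rewrite ler_pdivrMr //.
  have : 0 <= lambda * (s * z - w) by apply: mulr_ge0; lra.
  have -> : (w + lambda * z) * (s + lambda) =
    q + (s * w - aw) + lambda * (s * z - w) by rewrite /q; ring.
  lra.
rewrite mulrAC -mulrA.
have c0 : 0 <= 2 * omega - omega ^+ 2.
  have -> : 2 * omega - omega ^+ 2 = omega * (2 - omega) by ring.
  by apply: mulr_ge0; lra.
have := ler_wpM2l c0 qs.
have : 0 <= omega ^+ 2 * (lambda * z).
  by apply: mulr_ge0 (sqr_ge0 _) (mulr_ge0 l0 z0).
have -> : (2 * omega - omega ^+ 2) * (w + lambda * z) =
  2 * omega * (w + lambda * z) - omega ^+ 2 * w - omega ^+ 2 * (lambda * z) by ring.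
lra.
Qed.

Section Inverse.
Local Open Scope sesquilinear_scope.
Local Open Scope complex_scope.
Context {R : realType} {n3 : nat}.
Implicit Types m n p : nat.

Lemma tinvP n (D : tensor R n n n3) : tinvertible D -> is_tinv D (tinv D).
Proof. exact: (@xgetPex _ D (fun B => is_tinv D B)). Qed.

(** Injectivity makes [bcirc D] an invertible matrix.  Solving
    [D *t B = tid] columnwise produces a tensor [B] without showing that the
    inverse matrix is block circulant, and cancelling [D] in
    [D *t (B *t D) = D *t tid] shows that [B] is also a left inverse. *)
Lemma inj_tinvertible n (D : tensor R n n n3) :
  (forall p (Z : tensor R n p n3), D *t Z = 0 -> Z = 0) -> tinvertible D.
Proof.
move=> Dinj; have Du : bcirc D \in unitmx.
  rewrite unitmxE unitfE -det_tr; apply/negP => /det0P [v vn0 vD].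
  have fv : fold v^T = 0 :> tensor R n 1 n3.
    apply: Dinj; rewrite /tmul foldK -[bcirc D]trmxK -trmx_mul vD trmx0.
    by apply/ffunP => k; apply/matrixP => i j; rewrite !(ffunE, mxE).
  case/eqP: vn0; rewrite -[v]trmxK -[v^T]foldK fv; apply/matrixP => i j.
  by rewrite !mxE ffunE mxE.
exists (fold (invmx (bcirc D) *m unfold tid)).
have DB : D *t fold (invmx (bcirc D) *m unfold tid) = tid.
  by rewrite {1}/tmul foldK mulKVmx // unfoldK.
split=> //; apply/eqP; rewrite -subr_eq0; apply/eqP/Dinj.
by rewrite tmulBr tmulA DB t1mul tmul1 subrr.
Qed.

Lemma tdot_subZ m n a (X Y : tensor R m n n3) :
  tdot (X - a%:C *: Y) (X - a%:C *: Y) =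
  tdot X X - 2 * a * tdot X Y + a ^+ 2 * tdot Y Y.
Proof.
rewrite -scaleNr -rmorphN /= !(tdotDl, tdotDr, tdotZl, tdotZr) (tdotC Y X).
ring.
Qed.

(** Expand [0 <= |Y + a X|^2 / a]. *)
Lemma tdot_sub_young m n a (X Y : tensor R m n n3) : 0 < a ->
  tdot (X - Y) (X - Y) <= (1 + a) * tdot X X + (1 + a^-1) * tdot Y Y.
Proof.
move=> a0; rewrite -[Y in X - Y]scale1r -(rmorph1 (real_complex R)) tdot_subZ.
have := tdot_ge0 (Y - (- a)%:C *: X); rewrite tdot_subZ (tdotC Y X).
have a'0 : 0 < a^-1 by rewrite invr_gt0.
rewrite -(pmulr_rge0 _ a'0).
have -> : a^-1 * (tdot Y Y - 2 * - a * tdot X Y + (- a) ^+ 2 * tdot X X) =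
  a^-1 * tdot Y Y + 2 * tdot X Y + a * tdot X X.
  by field; rewrite gt_eqF.
lra.
Qed.

Section DampedGram.
Context {m n : nat} (A : tensor R m n n3) (lambda : R).
Hypothesis lambda_ge0 : 0 <= lambda.
Let D := A *t tctr A + lambda%:C *: tid.

Lemma damped_gramE p (Z : tensor R m p n3) :
  D *t Z = A *t (tctr A *t Z) + lambda%:C *: Z.
Proof. by rewrite tmulDl tmulZl t1mul tmulA. Qed.

(** For positive [lambda] the damped Gram tensor is positive definite, since
    [<D Z, Z> = |A^* Z|^2 + lambda |Z|^2], hence injective; for [lambda = 0]
    it is the Gram tensor itself. *)
Lemma tinvertible_damped_gram : tinvertible (A *t tctr A) -> tinvertible D.
Proof.
have [l0 _|l0] := ltrP 0 lambda; last first.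
  have -> : D = A *t tctr A; last by [].
  by rewrite /D (@le_anti _ _ lambda 0) ?l0 // rmorph0 scale0r addr0.
apply: inj_tinvertible => p Z /(congr1 (fun Y => tdot Y Z)).
rewrite damped_gramE tdotDl tdotMl tdotZl.
have -> : tdot (0 : tensor R m p n3) Z = 0.
  by rewrite -[0](scale0r Z) -(rmorph0 (real_complex R)) tdotZl mul0r.
move=> /eqP; rewrite paddr_eq0 ?tdot_ge0 ?mulr_ge0 ?tdot_ge0 //.
by rewrite mulf_eq0 (gt_eqF l0) => /andP [_ /eqP]; apply: tdot_eq0.
Qed.

(** All quantities are expressed through [Z = D^-1 A E] and [W = A^* Z]:
    adjointness gives [<E, W> = <A E, Z> = <D Z, Z>], which leaves an
    inequality between real numbers. *)
Lemma damped_projection_le p (s omega : R) (E : tensor R n p n3) :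
  0 < omega < 2 -> 0 < s -> tinvertible D ->
  (forall X : tensor R n p n3, tdot (A *t X) (A *t X) <= s * tdot X X) ->
  let W := tctr A *t tinv D *t (A *t E) in
  tdot (E - omega%:C *: W) (E - omega%:C *: W) <=
  tdot E E - (2 * omega - omega ^+ 2) / (s + lambda) * tdot (A *t E) (A *t E).
Proof.
move=> /andP [w0 w2] s0 /tinvP [DV _] As; rewrite -tmulA.
set Z := tinv D *t _; set W := tctr A *t Z => /=.
have AE : A *t E = A *t W + lambda%:C *: Z.
  by rewrite -damped_gramE tmulA DV t1mul.
have WW : tdot (A *t W) Z = tdot W W by rewrite tdotMl.
have EW : tdot E W = tdot W W + lambda * tdot Z Z.
  by rewrite -tdotMl AE tdotDl tdotZl WW.
have AE2 : tdot (A *t E) (A *t E) =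
    tdot (A *t W) (A *t W) + 2 * lambda * tdot W W + lambda ^+ 2 * tdot Z Z.
  by rewrite AE !(tdotDl, tdotDr, tdotZl, tdotZr) (tdotC Z) WW; ring.
rewrite tdot_subZ EW AE2.
apply: damped_quadratic_le; rewrite ?tdot_ge0 ?w0 //.
by have := tdot_ge0 (A *t W - s%:C *: Z); rewrite tdot_subZ WW.
Qed.
End DampedGram.
End Inverse.

(** * Mean contraction of one iteration *)

Section Rows.
Context {R : realType} {m n n3 : nat}.
Implicit Types A X Y : tensor R m n n3.

Lemma hsliceB X Y i : hslice (X - Y) i = hslice X i - hslice Y i.
Proof. by apply/ffunP => k; rewrite !ffunE linearB. Qed.

Lemma tdot_hslice_le X i : tdot (hslice X i) (hslice X i) <= tdot X X.
Proof.
by rewrite [leRHS]tdot_rows (bigD1 i) //= lerDl sumr_ge0 // => k _; apply: tdot_ge0.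
Qed.

Lemma frob_neq0 X : X != 0 -> frob X ^+ 2 != 0.
Proof. by apply: contra_neq; rewrite frobE; apply: tdot_eq0. Qed.

Lemma row_prob_ge0 A i : 0 <= row_prob A i.
Proof. by rewrite divr_ge0 ?sqr_ge0. Qed.

Lemma row_prob_sum A : A != 0 -> \sum_i row_prob A i = 1.
Proof.
move=> /frob_neq0 A0; rewrite -mulr_suml -[X in _ / X]/(frob A ^+ 2).
apply: (mulIf A0); rewrite mul1r mulfVK // frobE tdot_rows.
by apply: eq_bigr => i _; rewrite frobE.
Qed.

Lemma row_prob_gt0_Iplus A i : 0 < row_prob A i -> i \in Iplus A.
Proof.
move=> p0; rewrite inE /= lt_neqAle sqrtr_ge0 andbT; apply: contraL p0 => /eqP f0.
by rewrite /row_prob -f0 expr0n mul0r ltxx.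
Qed.

Lemma row_prob0 A i : A != 0 -> ~~ (0 < row_prob A i) -> hslice A i = 0.
Proof.
move=> A0; rewrite lt_neqAle row_prob_ge0 andbT negbK eq_sym => /eqP p0.
apply: tdot_eq0; rewrite -frobE; apply/eqP; move/eqP: p0.
by rewrite mulf_eq0 invr_eq0 (negPf (frob_neq0 A0)) orbF.
Qed.

Lemma min_row_prob_ge0 A : 0 <= min_row_prob A.
Proof.
rewrite /min_row_prob; elim/big_ind: _ => // [x y x0 y0|i _].
  by rewrite le_min x0.
exact: row_prob_ge0.
Qed.

Lemma min_row_prob_le A i : 0 < row_prob A i -> min_row_prob A <= row_prob A i.
Proof. by move=> p0; rewrite /min_row_prob; apply: bigmin_le_cond. Qed.

(** Rows of zero probability are zero rows, so replacing every probability
    by the smallest positive one only decreases the mean, and what is left is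
    [min_row_prob A] times [|A E|^2], split by rows. *)
Lemma expected_residual_ge p A (E : tensor R n p n3) : (n <= m)%N -> A != 0 ->
  min_row_prob A * (sigma_min (bcirc A) ^+ 2 * tdot E E) <=
  \sum_i row_prob A i * tdot (hslice A i *t E) (hslice A i *t E).
Proof.
move=> nm A0.
apply: (le_trans (ler_wpM2l (min_row_prob_ge0 A) (tdot_ge_sigma_min A E nm))).
rewrite tdot_rows mulr_sumr ler_sum // => i _; rewrite hslice_tmul.
have [p0|p0] := boolP (0 < row_prob A i).
  by rewrite ler_wpM2r ?tdot_ge0 ?min_row_prob_le.
rewrite (row_prob0 A0 p0).
suff -> : 0 *t E = 0 :> tensor R 1 p n3.
  by rewrite /tdot big1 ?mulr0 // => k _; rewrite ffunE mxdot0.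
by rewrite -[0](scale0r (0 : tensor R 1 n n3)) tmulZl !scale0r.
Qed.

(** If the largest singular value were zero, [A = A *t tid] would have norm
    zero. *)
Lemma sigma_max_gt0 A : (0 < m * n3)%N -> A != 0 -> 0 < sigma_max (bcirc A) ^+ 2.
Proof.
move=> mn0 A0; rewrite lt_neqAle sqr_ge0 andbT eq_sym.
apply: contra_neq A0 => s0; apply: tdot_eq0; apply/le_anti.
by rewrite tdot_ge0 andbT; have := tdot_le_sigma_max A tid mn0; rewrite tmul1 s0 mul0r.
Qed.

Lemma rank_bcirc_neq0 A : (0 < \rank (bcirc A))%N -> A != 0.
Proof.
apply: contraTneq => ->; suff -> : bcirc (0 : tensor R m n n3) = 0 by rewrite mxrank0.
by apply/matrixP => i j; rewrite !mxE ffunE mxE.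
Qed.

(** Full column rank forces [bcirc A] to be tall, which is what the lower
    Rayleigh bound needs. *)
Lemma rank_bcirc_le A : (0 < n3)%N -> \rank (bcirc A) = (n * n3)%N -> (n <= m)%N.
Proof.
move=> n30 rA; have := rank_leq_row (bcirc A).
by rewrite rA sum_nat_const card_ord mulnC leq_pmul2l.
Qed.
End Rows.

(** One iteration with row [i], in the shape of the recursive equation of
    [sdtrk], to which it is convertible. *)
Definition sdtrk_step (R : realType) n1 n2 n3 n4 (A : tensor R n1 n2 n3)
    (B : tensor R n1 n4 n3) (omega lambda : R) (i : 'I_n1)
    (X : tensor R n2 n4 n3) : tensor R n2 n4 n3 :=
  X - omega%:C%C *: (damped_pinv A lambda i *t (hslice A i *t X - hslice B i)).

Section Step.
Local Open Scope complex_scope.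
Context {R : realType} {n1 n2 n3 n4 : nat}.
Variables (A EA : tensor R n1 n2 n3) (Xs : tensor R n2 n4 n3) (B EB : tensor R n1 n4 n3).
Hypothesis hB : A *t Xs = B.
Let At := A + EA.
Let Bt := B + EB.
Let r := EA *t Xs - EB.
Variables (omega lambda alpha : R).
Hypotheses (homega : 0 < omega < 2) (hlambda : 0 <= lambda) (halpha : 0 < alpha).
Hypothesis hinv : forall i, i \in Iplus At ->
  tinvertible (hslice At i *t tctr (hslice At i)).
Hypothesis hrank : \rank (bcirc At) = (n2 * n3)%N.
Hypotheses (hn1 : (0 < n1)%N) (hn2 : (0 < n2)%N) (hn3 : (0 < n3)%N).

(** Since [A *t Xs = B], the exact solution leaves in the perturbed system the
    residual [At *t Xs - Bt = EA *t Xs - EB], whatever the iterate is. *)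
Lemma perturbed_residual (X : tensor R n2 n4 n3) i :
  hslice At i *t X - hslice Bt i = hslice At i *t (X - Xs) + hslice r i.
Proof.
rewrite -!hslice_tmul -hsliceB -hsliceD; congr hslice.
rewrite tmulBr [At *t Xs]tmulDl hB /r /Bt !opprD !addrA.
set a := At *t X; rewrite -!addrA; congr (_ + (_ + _)).
by rewrite addrA addNr add0r.
Qed.

Lemma sdtrk_error (X : tensor R n2 n4 n3) i (E := X - Xs) :
  sdtrk_step At Bt omega lambda i X - Xs =
  (E - omega%:C *: (damped_pinv At lambda i *t (hslice At i *t E))) -
  omega%:C *: (damped_pinv At lambda i *t hslice r i).
Proof.
have sub_swap (V : zmodType) (x a b y : V) : x - (a + b) - y = x - y - a - b.
  by rewrite opprD addrA !(addrAC _ _ (- y)).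
rewrite /sdtrk_step perturbed_residual tmulDr scalerDr; exact: sub_swap.
Qed.

Let At_neq0 : At != 0.
Proof. by apply: rank_bcirc_neq0; rewrite hrank muln_gt0 hn2. Qed.
Let s := sigma_max (bcirc At) ^+ 2.

(** [damped_projection_le] is used with [s = sigma_max^2] of the whole tensor,
    which also bounds each row slice because a row of [At *t Y] has norm at
    most that of [At *t Y]. *)
Lemma sdtrk_step_le (X : tensor R n2 n4 n3) i (E := X - Xs) : i \in Iplus At ->
  tdot (sdtrk_step At Bt omega lambda i X - Xs)
       (sdtrk_step At Bt omega lambda i X - Xs) <=
  (1 + alpha) * (tdot E E - (2 * omega - omega ^+ 2) / (s + lambda) *
    tdot (hslice At i *t E) (hslice At i *t E)) +
  eta_alpha At alpha omega lambda * tdot r r.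
Proof.
move=> iI; have mn0 : (0 < n1 * n3)%N by rewrite muln_gt0 hn1.
rewrite sdtrk_error; apply: le_trans (tdot_sub_young _ _ halpha) _.
apply: lerD.
  apply: ler_wpM2l; first by rewrite addr_ge0 // ltW.
  apply: damped_projection_le => //.
  - exact: sigma_max_gt0.
  - exact/tinvertible_damped_gram/hinv.
  move=> Y; rewrite -hslice_tmul.
  exact: le_trans (tdot_hslice_le _ _) (tdot_le_sigma_max _ _ mn0).
rewrite /eta_alpha -mulrA ler_wpM2l ?addr_ge0 ?invr_ge0 ?(ltW halpha) //.
rewrite tdotZl tdotZr mulrA -expr2 /Defs.eta (mulrC n3%:R) -2!(mulrA (omega ^+ 2)).
rewrite ler_wpM2l ?sqr_ge0 //; apply: le_trans (tdotM_le _ _) _.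
rewrite -!mulrA ler_wpM2l ?ler0n // ler_pM ?tdot_ge0 ?tdot_hslice_le // -frobE.
exact: le_bigmax_cond.
Qed.

Lemma expected_sdtrk_step_le (X : tensor R n2 n4 n3) (E := X - Xs) :
  \sum_i row_prob At i * tdot (sdtrk_step At Bt omega lambda i X - Xs)
       (sdtrk_step At Bt omega lambda i X - Xs) <=
  rho_alpha At alpha omega lambda * tdot E E +
  eta_alpha At alpha omega lambda * tdot r r.
Proof.
set h := eta_alpha _ _ _ _ * _.
set c := (2 * omega - omega ^+ 2) / (s + lambda).
have c0 : 0 <= c.
  apply: divr_ge0; last by rewrite addr_ge0 ?sqr_ge0.
  have -> : 2 * omega - omega ^+ 2 = omega * (2 - omega) by ring.
  by case/andP: homega => w_gt0 w_lt2; apply: mulr_ge0; lra.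
have le_i i : row_prob At i * tdot (sdtrk_step At Bt omega lambda i X - Xs)
       (sdtrk_step At Bt omega lambda i X - Xs) <=
  row_prob At i * ((1 + alpha) * tdot E E + h) -
  (1 + alpha) * c * (row_prob At i * tdot (hslice At i *t E) (hslice At i *t E)).
  have [p0|p0] := boolP (0 < row_prob At i).
    apply: le_trans (ler_wpM2l (ltW p0) (sdtrk_step_le X (row_prob_gt0_Iplus p0))) _.
    by rewrite -/E -/c -/h; lra.
  have -> : row_prob At i = 0.
    by apply/eqP; rewrite eq_le row_prob_ge0 andbT leNgt.
  lra.
apply: le_trans (ler_sum _ (fun i _ => le_i i)) _.
rewrite sumrB -mulr_suml row_prob_sum // mul1r -mulr_sumr.
have := expected_residual_ge E (rank_bcirc_le hn3 hrank) At_neq0.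
move/(ler_wpM2l (mulr_ge0 (addr_ge0 ler01 (ltW halpha)) c0)).
rewrite /rho_alpha -/s.
have -> : (2 * omega - omega ^+ 2) * sigma_min (bcirc At) ^+ 2 / (s + lambda) =
  c * sigma_min (bcirc At) ^+ 2 by rewrite mulrAC.
by lra.
Qed.
End Step.

(** * Expectations over row histories *)

Section Sampling.
Local Open Scope classical_set_scope.
Context {d : measure_display} {Omega : measurableType d} {R : realType}.
Variable P : probability Omega R.

(** Decompose [F (H w)] over the level sets of [H]; finiteness of [T] replaces
    all integrability conditions by measurability of these sets. *)
Lemma expectation_finite (T : finType) (H : Omega -> T) (q F : T -> R) :
  (forall h, measurable (H @^-1` [set h])) ->
  (forall h, P (H @^-1` [set h]) = (q h)%:E) ->
  (forall h, 0 <= F h) ->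
  ('E_P[fun w => F (H w)] = (\sum_h F h * q h)%R%:E)%E.
Proof.
move=> mH PH F0; rewrite unlock.
have -> : (fun w => (F (H w))%:E) =
    (fun w => \sum_h (F h)%:E * (\1_(H @^-1` [set h]) w)%:E)%E.
  apply/funext => w; rewrite (bigD1 (H w)) //= big1 => [|h hw].
    by rewrite indicE mem_set // mule1 adde0.
  rewrite indicE memNset ?mule0 // => /= Hw; by rewrite Hw eqxx in hw.
rewrite ge0_integral_sum //; first last.
- by move=> h w _; rewrite mule_ge0 // lee_fin.
- move=> h; apply: emeasurable_funM; first exact: measurable_cst.
  by apply/measurable_EFinP; exact: measurable_indic.
rewrite -sumEFin; apply: eq_bigr => h _.
rewrite ge0_integralZl_EFin //.
- by rewrite integral_indic // setIT EFinM; congr (_ * _)%E; exact: PH.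
- by apply/measurable_EFinP; exact: measurable_indic.
Qed.

Context {n : nat} (p : 'I_n -> R) (rows : nat -> Omega -> 'I_n).
Hypothesis hrows : iid_sampling P p rows.

Definition history t (w : Omega) : {ffun 'I_t -> 'I_n} := [ffun k => rows (val k) w].

(** The sequence of rows that follows [h] up to time [t] and is [i] from then
    on.  Its value at [t] is [i], so a history together with the next row is
    again a cylinder, of length [t.+1]. *)
Definition extend t (h : {ffun 'I_t -> 'I_n}) (i : 'I_n) (s : nat) : 'I_n :=
  if insub s is Some k then h k else i.

Lemma extend_ord t (h : {ffun 'I_t -> 'I_n}) i (k : 'I_t) : extend h i (val k) = h k.
Proof. by rewrite /extend valK. Qed.

Lemma extend_last t (h : {ffun 'I_t -> 'I_n}) i : extend h i t = i.
Proof. by rewrite /extend insubF ?ltnn. Qed.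

Definition cylinder t (c : nat -> 'I_n) : set Omega :=
  \bigcap_(s in [set` iota 0 t]) rows s @^-1` [set c s].

Lemma cylinderP t c w : cylinder t c w <-> forall s, (s < t)%N -> rows s w = c s.
Proof.
by split=> cw s; have := cw s; rewrite /= mem_iota add0n.
Qed.

Lemma cylinder_measurable t c : measurable (cylinder t c).
Proof.
apply: bigcap_measurableType => s _; have [mrows _ _] := hrows.
exact: mrows.
Qed.

Lemma cylinder_prob t c : P (cylinder t c) = (\prod_(s < t) p (c s))%:E.
Proof.
have [_ prows indep] := hrows.
rewrite /cylinder (indep (iota 0 t) (fun s => [set c s])) ?iota_uniq //.
rewrite -(big_mkord xpredT (fun s => p (c s))) /index_iota subn0.
rewrite -prodEFin; apply: eq_bigr => s _; exact: prows.
Qed.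

Lemma preimage_history t h i : history t @^-1` [set h] = cylinder t (extend h i).
Proof.
apply/seteqP; split => w /=.
  move=> <-; apply/cylinderP => s st.
  by rewrite -[s]/(val (Ordinal st)) extend_ord ffunE.
move/cylinderP => hw; apply/ffunP => k.
by rewrite ffunE hw //= -(extend_ord h i).
Qed.

Lemma preimage_history_next t h i :
  (fun w => (history t w, rows t w)) @^-1` [set (h, i)] =
  cylinder t.+1 (extend h i).
Proof.
apply/seteqP; split => w /=.
  move=> [hh it]; have : cylinder t (extend h i) w by rewrite -preimage_history.
  move/cylinderP => hw; apply/cylinderP => s; rewrite ltnS leq_eqVlt.
  by case/predU1P => [->|/hw //]; rewrite it extend_last.
move/cylinderP => hw; congr pair; last by rewrite hw // extend_last.
suff : (history t @^-1` [set h]) w by [].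
by rewrite (preimage_history h i); apply/cylinderP => s st; rewrite hw // ltnW.
Qed.

Definition hist_prob t (h : {ffun 'I_t -> 'I_n}) : R := \prod_(k < t) p (h k).

Lemma prod_extend t (h : {ffun 'I_t -> 'I_n}) i :
  \prod_(s < t) p (extend h i s) = hist_prob h.
Proof. by apply: eq_bigr => k _; rewrite extend_ord. Qed.

Lemma expectation_history t (i0 : 'I_n) (F : {ffun 'I_t -> 'I_n} -> R) :
  (forall h, 0 <= F h) ->
  ('E_P[fun w => F (history t w)] = (\sum_h F h * hist_prob h)%R%:E)%E.
Proof.
move=> F0; apply: expectation_finite => // h; rewrite (preimage_history h i0).
  exact: cylinder_measurable.
by rewrite cylinder_prob prod_extend.
Qed.

Lemma sum_hist_prob t (i0 : 'I_n) : \sum_(h : {ffun 'I_t -> 'I_n}) hist_prob h = 1.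
Proof.
have := @expectation_history t i0 (fun=> 1) (fun=> ler01).
rewrite expectation_cst => -[->]; apply: eq_bigr => h _; by rewrite mul1r.
Qed.

(** Independence of the row drawn at time [t] from the preceding ones: the
    joint law of the history and the next row is the product law. *)
Lemma expectation_history_next t (F : {ffun 'I_t -> 'I_n} -> 'I_n -> R) :
  (forall h i, 0 <= F h i) ->
  ('E_P[fun w => F (history t w) (rows t w)] =
   (\sum_h (\sum_i p i * F h i) * hist_prob h)%R%:E)%E.
Proof.
move=> F0.
rewrite (@expectation_finite _ (fun w => (history t w, rows t w))
  (fun hi => hist_prob hi.1 * p hi.2) (fun hi => F hi.1 hi.2)) //.
- rewrite -(pair_bigA _ (fun h i => F h i * (hist_prob h * p i))) /=.
  congr EFin; apply: eq_bigr => h _; rewrite mulr_suml; apply: eq_bigr => i _.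
  by rewrite mulrCA mulrC (mulrC (F h i)).
- by move=> [h i]; rewrite preimage_history_next; exact: cylinder_measurable.
move=> [h i]; rewrite preimage_history_next cylinder_prob big_ord_recr /=.
by rewrite prod_extend extend_last.
Qed.

(** The conditional bound holds for each history, hence after averaging with
    the history weights; the constant [b] is unchanged because these weights
    sum to 1. *)
Lemma expectation_one_step t (i0 : 'I_n)
    (G : {ffun 'I_t -> 'I_n} -> R) (F : {ffun 'I_t -> 'I_n} -> 'I_n -> R) (a b : R) :
  (forall h, 0 <= G h) -> (forall h i, 0 <= F h i) -> (forall i, 0 <= p i) ->
  (forall h, \sum_i p i * F h i <= a * G h + b) ->
  ('E_P[fun w => F (history t w) (rows t w)] <=
   a%:E * 'E_P[fun w => G (history t w)] + b%:E)%E.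
Proof.
move=> G0 F0 p0 FG; rewrite expectation_history_next // (expectation_history i0) //.
rewrite -EFinM -EFinD lee_fin -[b in leRHS]mulr1 -(sum_hist_prob t i0).
rewrite !mulr_sumr -big_split ler_sum // => h _ /=.
by rewrite mulrA -mulrDl ler_wpM2r // prodr_ge0.
Qed.
End Sampling.

Lemma eq_rows_sdtrk (R : realType) n1 n2 n3 n4 (A : tensor R n1 n2 n3)
    (B : tensor R n1 n4 n3) (o l : R) X0 (r r' : nat -> 'I_n1) t :
  (forall s, (s < t)%N -> r s = r' s) ->
  sdtrk A B o l X0 r t = sdtrk A B o l X0 r' t.
Proof.
elim: t => [//|t IH] rr'.
have IHt : sdtrk A B o l X0 r t = sdtrk A B o l X0 r' t.
  by apply: IH => s st; apply: rr'; rewrite ltnS ltnW.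
by rewrite [LHS]/= [RHS]/= IHt (rr' t (ltnSn t)).
Qed.

(** * The one-step recursion of the expected error *)

Theorem theorem4p2 (R : realType) (n1 n2 n3 n4 : nat)
    (hn1 : (0 < n1)%N) (hn2 : (0 < n2)%N) (hn3 : (0 < n3)%N) (hn4 : (0 < n4)%N)
    (A EA : tensor R n1 n2 n3) (Xs : tensor R n2 n4 n3)
    (B EB : tensor R n1 n4 n3) (hB : A *t Xs = B)
    (At : tensor R n1 n2 n3) (hAt : At = A + EA)
    (Bt : tensor R n1 n4 n3) (hBt : Bt = B + EB)
    (hinv : forall i, i \in Iplus At ->
       tinvertible (hslice At i *t tctr (hslice At i)))
    (hrank : \rank (bcirc At) = (n2 * n3)%N)
    (omega lambda : R) (homega : 0 < omega < 2) (hlambda : 0 <= lambda)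
    (X0 : tensor R n2 n4 n3)
    (d : measure_display) (Omega : measurableType d) (P : probability Omega R)
    (rows : nat -> Omega -> 'I_n1)
    (hrows : iid_sampling P (row_prob At) rows)
    (X : nat -> Omega -> tensor R n2 n4 n3)
    (hX : forall t w, X t w = sdtrk At Bt omega lambda X0 (rows ^~ w) t)
    (alpha : R) (halpha : 0 < alpha) (t : nat) :
  ('E_P[fun w => (frob (X t.+1 w - Xs) ^+ 2)%R] <=
     (rho_alpha At alpha omega lambda)%:E *
       'E_P[fun w => (frob (X t w - Xs) ^+ 2)%R] +
     (eta_alpha At alpha omega lambda * frob (EA *t Xs - EB) ^+ 2)%:E)%E.
Proof.
subst B At Bt; set At := A + EA; set Bt := A *t Xs + EB.
(* [i0] only pads histories into infinite sequences: [sdtrk] at time [t] does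
   not look at rows from time [t] on. *)
pose i0 := Ordinal hn1.
pose G (h : {ffun 'I_t -> 'I_n1}) := sdtrk At Bt omega lambda X0 (extend h i0) t.
have Gt w : sdtrk At Bt omega lambda X0 (rows ^~ w) t = G (history rows t w).
  apply: eq_rows_sdtrk => s st.
  by rewrite -[s in RHS]/(val (Ordinal st)) extend_ord ffunE.
pose f0 h := frob (G h - Xs) ^+ 2.
pose f1 h i := frob (sdtrk_step At Bt omega lambda i (G h) - Xs) ^+ 2.
have -> : (fun w => frob (X t.+1 w - Xs) ^+ 2) =
    (fun w => f1 (history rows t w) (rows t w)).
  by apply/funext => w; rewrite hX /= Gt.
have -> : (fun w => frob (X t w - Xs) ^+ 2) = (fun w => f0 (history rows t w)).
  by apply/funext => w; rewrite hX Gt.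
apply: (@expectation_one_step _ _ _ _ _ _ _ hrows t i0 f0 f1) => [h|h i|i|h].
- exact: sqr_ge0.
- exact: sqr_ge0.
- exact: row_prob_ge0.
rewrite /f0 /f1 !frobE; under eq_bigr do rewrite frobE.
exact: expected_sdtrk_step_le.
Qed.
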